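(* Consider the following algorithm for the laminar matroid secretary problem with a fixed drawing: set $\mathrm{ALG}\gets\emptyset$, draw $s\sim\mathrm{Bin}(n,p)$. If $s=0$, set $\mathrm{ALG}\gets\{r_1\}$. Otherwise set $B\gets\emptyset$ and for $i=s+1,\dots,n$: if $r_i\in\mathrm{OPT}(R_i)$ and $\pi_{\mathrm{OPT}(R_s)}(r_i)\notin B$, set $\mathrm{ALG}\gets\mathrm{ALG}+r_i$ and $B\gets B\cup\{\pi_{\mathrm{OPT}(R_s)}(r_i)\}$. Return $\mathrm{ALG}$. This algorithm has forbidden sets of size $3$. With $p=1/\sqrt3$ it is $3\sqrt3$ probability-competitive for laminar matroids.
   Context: Laminar matroid $\mathcal{M}[R,\mathcal{L},c]$: $\mathcal{L}$ is a laminar family of nonempty subsets of $R$ (for $L,H\in\mathcal{L}$, $L\cap H\in\{L,H,\emptyset\}$), containing $R$ and all singletons, with capacities $c:\mathcal{L}\to\mathbb{Z}_{>0}$ ($c(\{r\})=1$); $X\subseteq R$ is independent iff $|X\cap L|\le c(L)$ for all $L\in\mathcal{L}$; $|R|=n$. Tree: the Hasse diagram of $(\mathcal{L},\subseteq)$ is a tree rooted at $R$ whose leaves are the singletons (identified with the elements); add a new root $s$ as parent of $R$. Fix a planar drawing of this tree and number the leaves $1,\dots,n$ from left to right (so $R=[n]$), and add two further leaves $0$ (leftmost) and $n+1$ (rightmost) as children of $s$. For nodes $x,y$, write $x\sqsubseteq y$ if $y$ lies on the path from $s$ to $x$ ($y$ is an ancestor of $x$; $\sqsubset$ strict), and $x\vee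 y$ for their lowest common ancestor. For $J\subseteq[n]$ and $y$: $\mathrm{pre}_J(y)$ is the closest element of $J\cup\{0\}$ strictly left of $y$, $\mathrm{nex}_J(y)$ the closest element of $J\cup\{n+1\}$ strictly right of $y$, $J+y=J\cup\{y\}$. For nonempty $J\subseteq[n]$ and $y\in[n]$, the representative $\pi_J(y)$ is $y$ if $y\in J$; otherwise, with $a=\mathrm{pre}_{J+y}(y)$, $b=\mathrm{nex}_{J+y}(y)$, it is $a$ if $y\vee a\sqsubset y\vee b$ and $b$ if $y\vee a\sqsupseteq y\vee b$. Ordinal MSP setting: total order $\succ$ on $R$; $\mathrm{OPT}(Q)$ is the greedy (lexicographically maximum w.r.t. $\succ$) base of $Q\subseteq R$, $\mathrm{OPT}=\mathrm{OPT}(R)$; elements arrive in uniformly random order $r_1,\dots,r_n$, $R_t=\{r_1,\dots,r_t\}$. Probability-competitive: $\Pr(e\in\mathrm{ALG})\ge1/\alpha$ for all $e\in\mathrm{OPT}$. Forbidden sets of size $k$: (1) output always independent; (2) draws $s\sim\mathrm{Bin}(n,p)$ and accepts none of the first $s$ elements; (3) for every $(X,Y,r^* )$ with $Y\subseteq R$, $r^*\in\mathrm{OPT}(Y)$, $X\subseteq Y\setminus\{r^*\}$ there is $\mathcal{F}(X,Y,r^* )\subseteq X$ with at most $k$ elements such that for every $t\ge s+1$, if $r_t\in\mathrm{OPT}(R_t)$ and $r_j\notin\mathcal{F}(R_j,R_t,r_t)$ for all $j\in\{s+1,\dots,t-1\}$ then $r_t$ is selected. *)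

(* Defs.v *)
(* MathComp world (finite combinatorics); the reals and the binomial pmf come
   from MathComp-Analysis. *)
From mathcomp Require Import all_boot all_order all_algebra all_fingroup.
From mathcomp Require Import reals binomial_distribution.

Set Implicit Arguments.
Unset Strict Implicit.
Unset Printing Implicit Defensive.

(* Conventions.  The ground set [n] is 'I_n, the leaf numbered k (1 <= k <= n)
   being the ordinal k - 1.  The leaves of the tree extended by the root s are
   the numbers 0, ..., n + 1, i.e. 'I_n.+2, and [leaf] is the inclusion of [n]
   into them.  A tree node is identified with the set of leaves below it, so
   that "y is an ancestor of x" is x \subset y. *)

Section LaminarFamily.
Variable n : nat.
Implicit Types (L : {set {set 'I_n}}) (c : {set 'I_n} -> nat).

Definition laminar_family L : Prop :=
  [/\ {in L &, forall A B, A :&: B \in [set A; B; set0]},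
      set0 \notin L,
      [set: 'I_n] \in L
    & forall r, [set r] \in L].

Definition capacities L c : Prop :=
  {in L, forall A, 0 < c A} /\ forall r, c [set r] = 1.

Definition laminar_indep L c (X : {set 'I_n}) : bool :=
  [forall A in L, #|X :&: A| <= c A].

(* Covering relation, i.e. edges of the Hasse diagram of (L, \subset). *)
Definition child L (x y : {set 'I_n}) : bool :=
  [&& x \in L, y \in L, x \proper y
    & [forall z in L, ~~ ((x \proper z) && (z \proper y))]].

(* A planar drawing of the rooted tree L is, combinatorially, a strict linear
   left-to-right order on the children of each node. *)
Definition drawing L (lft : rel {set 'I_n}) : Prop :=
  {in L, forall y,
    [/\ {in child L ^~ y, irreflexive lft},
        {in child L ^~ y & &, transitive lft}
      & {in child L ^~ y &, forall x z, x != z -> lft x z || lft z x}]}.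

(* Leaf i is drawn to the left of leaf j: the branches leading to i and to j
   leave some node y in this order. *)
Definition drawn_left L (lft : rel {set 'I_n}) (i j : 'I_n) : Prop :=
  exists x y z, [/\ child L x y, child L z y, lft x z, i \in x & j \in z].

Definition numbered_left_to_right L (lft : rel {set 'I_n}) : Prop :=
  forall i j : 'I_n, i < j <-> drawn_left L lft i j.

Definition leaf (i : 'I_n) : 'I_n.+2 := inord i.+1.

(* The root s has all leaves below it; its children are 0, R and n + 1. *)
Definition root_s : {set 'I_n.+2} := setT.

Definition nodes L : {set {set 'I_n.+2}} :=
  [set leaf @: A | A : {set 'I_n} in L]
    :|: [set [set ord0]; [set ord_max]; root_s].

(* Lowest common ancestor of two leaves. *)
Definition lca L (x y : 'I_n.+2) : {set 'I_n.+2} :=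
  [arg min_(z < root_s | [&& z \in nodes L, x \in z & y \in z]) #|z|].

Definition pre (J : {set 'I_n.+2}) (y : 'I_n.+2) : 'I_n.+2 :=
  [arg max_(i > ord0 | (i \in ord0 |: J) && (i < y)) (i : nat)].

Definition nex (J : {set 'I_n.+2}) (y : 'I_n.+2) : 'I_n.+2 :=
  [arg min_(i < ord_max | (i \in ord_max |: J) && (y < i)) (i : nat)].

(* The representative pi_J(y), as a leaf of the extended tree (it lies in J
   whenever J is nonempty). *)
Definition representative L (J : {set 'I_n}) (y : 'I_n) : 'I_n.+2 :=
  let y' := leaf y in
  let Jy := leaf @: (y |: J) in
  let a := pre Jy y' in
  let b := nex Jy y' in
  if y \in J then y'
  else if lca L y' a \proper lca L y' b then a else b.

End LaminarFamily.

Section OrdinalMSP.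
Variable n : nat.
(* [pref x y] reads "x is at least as good as y". *)
Implicit Types (indep : pred {set 'I_n}) (pref : rel 'I_n) (sigma : 'S_n).

Definition linear_order pref : Prop :=
  [/\ reflexive pref, antisymmetric pref, transitive pref & total pref].

Definition OPT indep pref (Q : {set 'I_n}) : {set 'I_n} :=
  foldl (fun A r => if indep (r |: A) then r |: A else A) set0
        (sort pref (enum Q)).

(* An arrival order is a permutation sigma: r_{i+1} is [sigma i] for i : 'I_n,
   and [arrived sigma t] is R_t. *)
Definition arrived sigma (t : nat) : {set 'I_n} :=
  [set sigma i | i : 'I_n & i < t].

(* A sample-based algorithm draws a sample size s in {0, ..., n} from
   [sample_law], independently of the arrival order, and then outputs
   [output s sigma]. *)
Record algorithm (R : realType) := Algorithm {
  sample_law : 'I_n.+1 -> R;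
  output : 'I_n.+1 -> 'S_n -> {set 'I_n}
}.

Definition prob_selected (R : realType) (A : algorithm R) (e : 'I_n) : R :=
  (\sum_(s < n.+1) sample_law A s *
     (#|[set sigma : 'S_n | e \in output A s sigma]|%:R / #|'S_n|%:R))%R.

Definition probability_competitive (R : realType) indep pref
    (alpha : R) (A : algorithm R) : Prop :=
  forall e, e \in OPT indep pref setT -> (alpha^-1 <= prob_selected A e)%R.

Definition has_forbidden_sets (R : realType) indep pref
    (p : R) (k : nat) (A : algorithm R) : Prop :=
  [/\ forall s sigma, indep (output A s sigma),
      (forall s : 'I_n.+1, sample_law A s = binomial_pmf n p s) /\
      (forall (s : 'I_n.+1) sigma (i : 'I_n), i < s -> sigma i \notin output A s sigma)
    & exists F : {set 'I_n} -> {set 'I_n} -> 'I_n -> {set 'I_n},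
        (forall (X Y : {set 'I_n}) r, r \in OPT indep pref Y -> X \subset Y :\ r ->
           F X Y r \subset X /\ #|F X Y r| <= k) /\
        (forall (s : 'I_n.+1) sigma (t : 'I_n), s <= t ->
           sigma t \in OPT indep pref (arrived sigma t.+1) ->
           (forall j : 'I_n, s <= j < t ->
              sigma j \notin
                F (arrived sigma j.+1) (arrived sigma t.+1) (sigma t)) ->
           sigma t \in output A s sigma)].

End OrdinalMSP.

Section LaminarAlgorithm.
Variables (n : nat) (L : {set {set 'I_n}}) (c : {set 'I_n} -> nat).
Variable pref : rel 'I_n.

Definition laminar_OPT := OPT (laminar_indep L c) pref.

(* One round of the loop; the state is (ALG, B). *)
Definition laminar_step (s : nat) (sigma : 'S_n)
    (st : {set 'I_n} * {set 'I_n.+2}) (i : 'I_n) :=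
  let r := sigma i in
  let rep := representative L (laminar_OPT (arrived sigma s)) r in
  if (r \in laminar_OPT (arrived sigma i.+1)) && (rep \notin st.2)
  then (r |: st.1, rep |: st.2) else st.

(* For s = 0 the output {r_1} is R_1. *)
Definition laminar_output (s : 'I_n.+1) (sigma : 'S_n) : {set 'I_n} :=
  if s == 0 :> nat then arrived sigma 1
  else (foldl (laminar_step s sigma) (set0, set0)
              [seq i : 'I_n <- enum 'I_n | s <= i]).1.

Definition laminar_algorithm (R : realType) (p : R) : algorithm n R :=
  Algorithm (fun s => binomial_pmf n p s) laminar_output.

End LaminarAlgorithm.

(* Main.v *)
(* The nodes of the tree are intervals of leaves, so pi_J sends the leaves of a node A into
   A if J meets A, and is constant on A otherwise.  Hence a set on which pi_J is injective
   is independent as soon as J is.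

   For J included in J' one has pi_J o pi_J' = pi_J.  Let J_k = OPT(R_k) and let F(X, Y, r)
   consist of u = pi_OPT(X)(r) and the two neighbours of u in OPT(X).  If r_j, in OPT(R_j),
   is not in F(R_j, Y, r), then r_j and r have different images under pi_{J_j}.  Going
   backwards, J_{k-1} contains J_k - r_k; when r_k is neither u nor next to u in J_k, removing
   r_k merges nothing into the class of u, and adding elements only refines the classes.
   So the images still differ under pi_{J_s}, and r is not blocked by r_j.

   For the competitive ratio, given R_t and r_t = e the probability that r_j is not forbidden
   for s < j < t is at least prod (j - 3) / j, a ratio of falling factorials.  The sum over t
   telescopes, and the first and third factorial moments of the binomial law turn the bound
   into (p - p^3) / 2, which equals 1 / (3 sqrt 3) at p = 1 / sqrt 3. *)

Require Import Defs.
From mathcomp Require Import all_boot all_order all_algebra all_fingroup.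
From mathcomp Require Import reals binomial_distribution.
From mathcomp Require Import zify ring lra.

Set Implicit Arguments.
Unset Strict Implicit.
Unset Printing Implicit Defensive.

(** * Representatives in a laminar family of intervals *)

Section Representative.
Variables (n : nat) (L : {set {set 'I_n}}).
Hypothesis laminarL : laminar_family L.
Hypothesis convexL : forall (A : {set 'I_n}) (i j k : 'I_n),
  A \in L -> i \in A -> k \in A -> i <= j <= k -> j \in A.
Implicit Types (J K A B : {set 'I_n}) (x y z w : 'I_n).

Lemma laminar_comparable A B x :
  A \in L -> B \in L -> x \in A -> x \in B -> A \subset B \/ B \subset A.
Proof.
have [lamL _ _ _] := laminarL => AL BL xA xB.
have := lamL _ _ AL BL; rewrite !inE.
have xAB : x \in A :&: B by rewrite inE xA.
case/orP=> [/orP[]|] /eqP AB.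
- by left; apply/setIidPl.
- by right; apply/setIidPr.
- by rewrite AB inE in xAB.
Qed.

(* [z] is pi_J(y), with y ∨ a ⊏ y ∨ b read as: some node contains y and a but
   not b.  Quantifying over all of J on the other side of [y], rather than over its
   nearest element only, is harmless because nodes are intervals. *)
Definition represents J y z : Prop :=
  z \in J /\
  if y <= z
  then forall a, a \in J -> a < z ->
         a < y /\ {in L, forall A, a \in A -> y \in A -> z \in A}
  else forall b, b \in J -> z < b ->
         y < b /\ exists A, [/\ A \in L, z \in A, y \in A & b \notin A].

Lemma represents_self J y : y \in J -> represents J y y.
Proof. by move=> yJ; split=> //; rewrite leqnn => a aJ ay; split=> // A AL _. Qed.

(** Candidates on the same side of [y] contradict the nearest-element clause. On opposite sides, the
    left one supplies a node that omits the right one, while the right one must lie in every such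
    node. *)
Lemma represents_uniq J y z w : represents J y z -> represents J y w -> z = w.
Proof.
move=> [zJ Hz] [wJ Hw]; case: (ltngtP z w) => [zw|wz|/val_inj//].
- case: (leqP y w) Hw Hz => yw; case: (leqP y z) => yz Hw Hz.
  + by have [] := Hw _ zJ zw; lia.
  + have [_ [A [AL zA yA /negP wA]]] := Hz _ wJ zw.
    by have [_ /(_ _ AL zA yA)] := Hw _ zJ zw.
  + by lia.
  + by have [] := Hz _ wJ zw; lia.
- case: (leqP y w) Hw Hz => yw; case: (leqP y z) => yz Hw Hz.
  + by have [] := Hz _ wJ wz; lia.
  + by lia.
  + have [_ [A [AL zA yA /negP wA]]] := Hw _ zJ wz.
    by have [_ /(_ _ AL zA yA)] := Hz _ wJ wz.
  + by have [] := Hw _ zJ wz; lia.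
Qed.

Lemma represents_mem J y z : y \in J -> represents J y z -> z = y.
Proof. by move=> /represents_self yy /represents_uniq; apply. Qed.

(** If [z] lies between [y] and [w], convexity suffices. Otherwise the definition applies directly
    on the right, and on the left the separating node misses [w], hence lies inside [A]. *)
Lemma represents_in J y z w A :
  represents J y z -> A \in L -> y \in A -> w \in A -> w \in J -> z \in A.
Proof.
move=> [zJ Hz] AL yA wA wJ; case: (leqP y z) Hz => yz Hz.
- case: (leqP z w) => [zw|/(Hz _ wJ)[_]]; last exact.
  by apply: (convexL AL yA wA); rewrite yz.
- case: (leqP w z) => [wz|/(Hz _ wJ)[_ [B [BL zB yB wB]]]].
    by apply: (convexL AL wA yA); rewrite wz ltnW.
  have [/subsetP AB|/subsetP BA] := laminar_comparable AL BL yA yB.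
    by rewrite AB in wB.
  exact: BA.
Qed.

(** The interval [A] misses [J], so its points see the same elements of [J] on each side, and a node
    meeting both [A] and [J] contains [A]. *)
Lemma represents_const J x y z A :
  represents J x z -> A \in L -> x \in A -> y \in A -> [disjoint J & A] ->
  represents J y z.
Proof.
move=> [zJ Hz] AL xA yA JA; split=> //.
have notA a : a \in J -> a \in A = false by apply: disjointFr.
have zA := notA _ zJ.
case: (leqP x z) Hz => xz Hz.
- have -> : y <= z.
    case: leqP => // zy; have := convexL AL xA yA (j := z).
    by rewrite zA => ->; rewrite // xz ltnW.
  move=> a aJ az; have [ax ga] := Hz _ aJ az; split.
    case: ltnP => // ya; have := convexL AL yA xA (j := a).
    by rewrite notA // => ->; rewrite // ya ltnW.
  move=> B BL aB yB; apply: ga => //.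
  have [/subsetP AB|/subsetP BA] := laminar_comparable AL BL yA yB.
    exact: AB.
  by have := notA _ aJ; rewrite BA.
- have -> : y <= z = false.
    case: leqP => // yz; have := convexL AL yA xA (j := z).
    by rewrite zA => ->; rewrite // yz ltnW.
  move=> b bJ zb; have [xb [B [BL zB xB bB]]] := Hz _ bJ zb; split.
    case: ltnP => // bly; have := convexL AL xA yA (j := b).
    by rewrite notA // => ->; rewrite // bly ltnW.
  exists B; split=> //.
  have [/subsetP AB|/subsetP BA] := laminar_comparable AL BL xA xB.
    exact: AB.
  by rewrite BA in zA.
Qed.

Lemma represents_trans J K y w z :
  K \subset J -> represents J y w -> represents K w z -> represents K y z.
Proof.
move=> /subsetP KJ [wJ Hw] [zK Hz]; split=> //.
have zJ := KJ _ zK.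
case: (leqP y w) Hw => yw Hw; case: (leqP w z) Hz => wz Hz.
- rewrite (leq_trans yw wz) => a aK az.
  have [aw ga] := Hz _ aK az; have [ay gb] := Hw _ (KJ _ aK) aw; split=> // A AL aA yA.
  exact: ga (gb _ AL aA yA).
- have [zy _] := Hw _ zJ wz; rewrite leqNgt zy => b bK zb /=.
  have [wb [A [AL zA wA bA]]] := Hz _ bK zb; split; first exact: leq_ltn_trans wb.
  exists A; split=> //; apply: (convexL AL zA wA); by rewrite yw ltnW.
- case: (ltngtP w z) wz => // [wz|/val_inj wz] _.
    have [yz _] := Hw _ zJ wz; rewrite (ltnW yz) => a aK az.
    have [aw ga] := Hz _ aK az; split; first exact: ltn_trans yw.
    move=> A AL aA yA; apply: ga => //; apply: (convexL AL aA yA).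
    by rewrite ltnW // ltnW.
  rewrite -wz leqNgt yw => b bK /=; exact/Hw/KJ.
- rewrite leqNgt (ltn_trans wz yw) => b bK zb /=.
  have [wb [A [AL zA wA bA]]] := Hz _ bK zb.
  have [yb [B [BL wB yB bB]]] := Hw _ (KJ _ bK) wb; split=> //.
  (* The two nodes share [w], hence are nested; neither contains [b], and the larger contains both
     [z] and [y]. *)
  have [/subsetP AB|/subsetP BA] := laminar_comparable AL BL wA wB.
    by exists B; split=> //; apply: AB.
  by exists A; split=> //; apply: BA.
Qed.

(** * From the extended tree to the relation [represents] *)

Lemma leafK (x : 'I_n) : leaf x = x.+1 :> nat.
Proof. by rewrite inordK // !ltnS ltnW. Qed.

Lemma leaf_inj : injective (@leaf n).
Proof. by move=> x y /(congr1 val); rewrite /= !leafK => -[] /val_inj. Qed.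

Lemma mem_leaf A x : (leaf x \in @leaf n @: A) = (x \in A).
Proof. exact/mem_imset/leaf_inj. Qed.

Lemma leaf_of (i : 'I_n.+2) : 0 < i < n.+1 -> exists x : 'I_n, i = leaf x.
Proof.
move=> Hi; have lt : i.-1 < n by lia.
by exists (Ordinal lt); apply: val_inj; rewrite /= leafK /=; lia.
Qed.

Lemma node_leafP (z : {set 'I_n.+2}) y : z \in nodes L -> leaf y \in z ->
  z = setT \/ exists2 A, A \in L & z = @leaf n @: A.
Proof.
have ne : (leaf y != ord0) && (leaf y != ord_max).
  by rewrite -!val_eqE /= leafK; have := ltn_ord y; lia.
rewrite !inE => /orP[/imsetP[A AL ->]|]; first by right; exists A.
move=> /orP[/orP[]|] /eqP ->; last (by left); rewrite inE => /eqP ly.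
  by rewrite ly eqxx in ne.
by rewrite ly eqxx andbF in ne.
Qed.

(** [lca] minimises cardinality; the nodes through [leaf y] form a chain, so the minimiser is also
    least for inclusion. *)
Lemma lcaP y (w : 'I_n.+2) :
  [/\ lca L (leaf y) w \in nodes L, leaf y \in lca L (leaf y) w,
      w \in lca L (leaf y) w
    & {in nodes L, forall z : {set 'I_n.+2},
        leaf y \in z -> w \in z -> lca L (leaf y) w \subset z}].
Proof.
rewrite /lca; case: arg_minnP => [|u /and3P[uN yu wu] umin].
  by rewrite !inE eqxx !orbT.
split=> // z zN yz wz.
have [->|[A AL zA]] := node_leafP zN yz; first exact: subsetT.
have [uT|[B BL uB]] := node_leafP uN yu.
  have := umin z; rewrite zN yz wz => /(_ isT); rewrite uT => le.
  suff -> : z = setT by [].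
  by apply/eqP; rewrite eqEcard subsetT.
have yA : y \in A by rewrite -mem_leaf -zA.
have yB : y \in B by rewrite -mem_leaf -uB.
have [AB|BA] := laminar_comparable AL BL yA yB; last by rewrite uB zA imsetS.
have := umin z; rewrite zN yz wz => /(_ isT) le.
suff -> : u = z by [].
by apply/esym/eqP; rewrite eqEcard le zA uB imsetS.
Qed.

Lemma leaf_convex A x w (i : 'I_n.+2) : A \in L -> x \in A -> w \in A ->
  leaf x <= i <= leaf w -> i \in @leaf n @: A.
Proof.
move=> AL xA wA; rewrite !leafK => /andP[xi iw].
have [|v iv] := @leaf_of i; first by move: xi iw (ltn_ord w); clear; lia.
rewrite iv mem_leaf; apply: (convexL AL xA wA); move: xi iw; rewrite iv leafK.
by rewrite !ltnS => -> ->.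
Qed.

Lemma representativeP J y : J != set0 ->
  exists2 z, representative L J y = leaf z & represents J y z.
Proof.
move=> /set0Pn[j0 j0J]; rewrite /representative.
case: ifP => yJ; first by exists y => //; apply: represents_self.
set Jy := @leaf n @: (y |: J).
have memJy x : (leaf x \in Jy) = (x \in y |: J) by rewrite mem_leaf.
have [_ _ LT _] := laminarL.
have RN : @leaf n @: [set: 'I_n] \in nodes L.
  by rewrite inE; apply/orP; left; apply/imsetP; exists setT.
have nRord0 A : ord0 \notin @leaf n @: A.
  by apply/imsetP => -[x _ /(congr1 val)]; rewrite /= leafK.
have nRmax A : ord_max \notin @leaf n @: A.
  apply/imsetP => -[x _ /(congr1 val)]; rewrite /= leafK; have := ltn_ord x; lia.
rewrite /pre; case: arg_maxnP => [|a /andP[aJ ay] amax].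
  by rewrite !inE eqxx leafK.
rewrite /nex; case: arg_minnP => [|b /andP[bJ yb] bmin].
  by rewrite !inE eqxx leafK /= ltnS ltn_ord.
have amaxJ x : x \in J -> x < y -> leaf x <= a.
  by move=> xJ xy; apply: amax; rewrite !inE memJy inE xJ !leafK ltnS xy !orbT.
have bminJ x : x \in J -> y < x -> b <= leaf x.
  by move=> xJ xy; apply: bmin; rewrite !inE memJy inE xJ !leafK ltnS xy !orbT.
have neqJ x : x \in J -> x != y :> nat.
  by move=> xJ; apply/eqP => /val_inj xy; rewrite -xy xJ in yJ.
have leafJ (i : 'I_n.+2) : i \in Jy -> i != leaf y -> exists2 x, x \in J & i = leaf x.
  move=> /imsetP[x]; rewrite !inE => /orP[/eqP ->|xJ ->]; first by move=> -> /eqP.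
  by move=> _; exists x.
have [lNa lya laa lmina] := lcaP y a; have [lNb lyb lbb lminb] := lcaP y b.
case: ifP => [/properP[sub [v vb nva]]|nprop].
(* A node properly inside another is not the root, so [a] is not the sentinel 0 and lies in [J]. *)
- have [lT|[A AL lA]] := node_leafP lNa lya; first by rewrite lT inE in nva.
  have aJ' : a \in Jy.
    move: aJ; rewrite !inE => /orP[/eqP a0|//].
    by rewrite lA a0 (negPf (nRord0 A)) in laa.
  have [|z zJ az] := leafJ _ aJ'; first by rewrite -val_eqE neq_ltn ay.
  exists z => //; split=> //.
  have zy : z < y by move: ay; rewrite az !leafK.
  rewrite leqNgt zy /= => x xJ zx.
  have yx : y < x.
    case: (ltngtP y x) => // [xy|/esym/eqP]; last by rewrite (negPf (neqJ _ xJ)).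
    by have := amaxJ _ xJ xy; rewrite az !leafK ltnS leqNgt zx.
  split=> //; exists A.
  split=> //; rewrite -?mem_leaf -?lA -?az //; apply/negP => xA.
  have bA : b \in lca L (leaf y) a.
    rewrite lA; apply: (leaf_convex (x := y) (w := x)) => //; rewrite -?mem_leaf -?lA //.
    by rewrite ltnW //= bminJ.
  have /subsetP/(_ _ vb) := lminb _ lNa lya bA; exact/negP.
(* Were [b] the sentinel [n + 1], all of [J] would be left of [y] and [a] a genuine leaf, so the lca
   with [a] would lie in [R], properly inside the root. *)
- have bJ' : b \in Jy.
    move: bJ; rewrite !inE => /orP[/eqP bm|//].
    have allleft x : x \in J -> x < y.
      move=> xJ; case: (ltngtP x y) (neqJ _ xJ) => // yx _.
      by have := bminJ _ xJ yx; rewrite bm leafK ltnS leqNgt ltn_ord.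
    have lT : lca L (leaf y) b = setT.
      have [//|[A AL lA]] := node_leafP lNb lyb.
      by rewrite lA bm (negPf (nRmax A)) in lbb.
    have ja := amaxJ _ j0J (allleft _ j0J).
    have [|z az] := @leaf_of a; first by move: ja ay; rewrite !leafK; move: (ltn_ord y); clear; lia.
    have sub : lca L (leaf y) a \subset @leaf n @: [set: 'I_n].
      by apply: lmina => //; rewrite ?az mem_leaf inE.
    move: nprop; rewrite lT properT; move/negbFE/eqP => lT'.
    by move: (nRord0 setT); rewrite lT' in sub; rewrite (subsetP sub).
  have [|z zJ bz] := leafJ _ bJ'; first by rewrite -val_eqE neq_ltn yb orbT.
  exists z => //; split=> //.
  have yz : y < z by move: yb; rewrite bz !leafK.
  rewrite (ltnW yz) => x xJ xz.
  have xy : x < y.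
    case: (ltngtP x y) (neqJ _ xJ) => // yx _.
    by have := bminJ _ xJ yx; rewrite bz !leafK ltnS leqNgt xz.
  split=> // A AL xA yA.
  have aA : a \in @leaf n @: A.
    by apply: (leaf_convex (x := x) (w := y)) => //; rewrite amaxJ //= ltnW.
  have AN : @leaf n @: A \in nodes L.
    by rewrite inE; apply/orP; left; apply/imsetP; exists A.
  have yA' : leaf y \in @leaf n @: A by rewrite mem_leaf.
  rewrite -mem_leaf -bz; apply: (subsetP (lmina _ AN yA' aA)).
  (* Both lcas contain [leaf y], so they are comparable; the failed strict inclusion puts the lca
     with [b] inside the one with [a]. *)
  have [->|[A1 A1L l1]] := node_leafP lNa lya; first by rewrite inE.
  have [lT|[A2 A2L l2]] := node_leafP lNb lyb.
    move: nprop; rewrite lT properT => /negbFE/eqP ->; exact: in_setT.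
  have yA1 : y \in A1 by rewrite -mem_leaf -l1.
  have yA2 : y \in A2 by rewrite -mem_leaf -l2.
  have [s12|s21] := laminar_comparable A1L A2L yA1 yA2.
    move: nprop; rewrite properE {1}l1 {1}l2 imsetS //= => /negbFE/subsetP; exact.
  have/subsetP : lca L (leaf y) b \subset lca L (leaf y) a by rewrite l1 l2 imsetS.
  exact.
Qed.

End Representative.

(** * The greedy base of a laminar matroid *)

(** Suppose [j] is between [i] and [k] but outside [A]. At the branching [y] of [i] and [j], [A] is
    properly inside [y], hence inside the child towards [i]; so [k] is in that child too and is
    drawn left of [j]. *)
Lemma numbered_convex n (L : {set {set 'I_n}}) lft :
  laminar_family L -> numbered_left_to_right L lft ->
  forall (A : {set 'I_n}) (i j k : 'I_n),
    A \in L -> i \in A -> k \in A -> i <= j <= k -> j \in A.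
Proof.
move=> lamL numL A i j k AL iA kA /andP[ij jk].
case: (ltngtP i j) ij => // [ij|/val_inj <- //] _.
apply: contraT => jA.
have [x [y [z [xy zy xz ix jz]]]] := (numL i j).1 ij.
have [xL yL /properP[/subsetP sxy _] /forall_inP between] := and4P xy.
have [_ _ /properP[/subsetP szy _] _] := and4P zy.
have Ay : A \proper y.
  have [Ay|yA] := laminar_comparable lamL AL yL iA (sxy _ ix).
    by apply/properP; split=> //; exists j => //; apply: szy.
  by rewrite (subsetP yA) ?szy in jA.
have Ax : A \subset x.
  have [//|xA] := laminar_comparable lamL AL xL iA ix.
  have := between _ AL; rewrite Ay andbT properE xA negbK; exact.
suff : k < j by rewrite ltnNge jk.
by apply/(numL k j); exists x, y, z; split=> //; apply: (subsetP Ax).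
Qed.

Section Greedy.
Variables (n : nat) (L : {set {set 'I_n}}) (c : {set 'I_n} -> nat).
Hypothesis laminarL : laminar_family L.
Hypothesis capacitiesL : capacities L c.
Implicit Types (A B D I G : {set 'I_n}) (l : seq 'I_n).
Local Notation indep := (laminar_indep L c).

Definition greedy l : {set 'I_n} :=
  foldl (fun A r => if indep (r |: A) then r |: A else A) set0 l.

Lemma greedy_rcons l r :
  greedy (rcons l r) =
  if indep (r |: greedy l) then r |: greedy l else greedy l.
Proof. by rewrite /greedy foldl_rcons. Qed.

Lemma greedy_indep l : indep (greedy l).
Proof.
elim/last_ind: l => [|l r IHl]; last by rewrite greedy_rcons; case: ifP.
by apply/forall_inP => A _; rewrite set0I cards0.
Qed.

Lemma greedy_sub l r : r \in greedy l -> r \in l.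
Proof.
elim/last_ind: l r => [|l x IHl] r; first by rewrite inE.
rewrite greedy_rcons mem_rcons inE; case: ifP => _; last by move/IHl ->; rewrite orbT.
by rewrite in_setU1 => /orP[->//|/IHl ->]; rewrite orbT.
Qed.

Lemma card_setU1I D r A : #|(r |: D) :&: A| = ((r \in A) && (r \notin D)) + #|D :&: A|.
Proof.
case rA: (r \in A); last first.
  apply: eq_card => x; rewrite !inE; case: eqP => [->|//]; by rewrite rA !andbF.
rewrite setIUl (setIidPl _) ?sub1set // cardsU1 inE rA andbT //.
Qed.

Lemma indepU1 D r : indep D ->
  reflect {in L, forall A, r \in A -> r \notin D -> #|D :&: A| < c A}
          (indep (r |: D)).
Proof.
move=> /forall_inP iD; apply: (iffP forall_inP) => [iU A AL rA rD|H A AL].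
  by have := iU A AL; rewrite card_setU1I rA rD.
rewrite card_setU1I; have := iD A AL; have := H A AL.
by case: (r \in A) => //; case: (r \in D) => // /(_ isT isT).
Qed.

(** When [x] was rejected some node through it was saturated, and the greedy set only grows
    afterwards. *)
Lemma greedy_blocked l x : x \in l -> x \notin greedy l ->
  exists A, [/\ A \in L, x \in A & c A <= #|greedy l :&: A|].
Proof.
elim/last_ind: l => [|l r IHl]; first by rewrite in_nil.
rewrite mem_rcons inE greedy_rcons.
have [/eqP -> _|nxr /= xl] := boolP (x == r).
  case: ifP => [_|/negbT ni rG]; first by rewrite setU11.
  move: ni; rewrite negb_forall_in => /exists_inP[A AL]; rewrite -ltnNge card_setU1I => lt.
  exists A; split=> //; move: lt; last by rewrite rG andbT; case: (r \in A) => //= /ltnW.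
  by case: (r \in A); rewrite //= add0n ltnNge (forall_inP (greedy_indep l)).
case: ifP => _; last exact: IHl.
rewrite in_setU1 negb_or => /andP[_ xG]; have [A [AL xA cA]] := IHl xl xG.
by exists A; split=> //; apply: leq_trans cA _; rewrite subset_leq_card // setSI // subsetUr.
Qed.

(* Peel off a maximal member of L on which G is at least as large as I. *)
Lemma card_le_blocked I G D :
  (forall x, x \in I -> x \in D -> x \notin G ->
     exists B, [/\ B \in L, x \in B, B \subset D & #|I :&: B| <= #|G :&: B|]) ->
  #|I :&: D| <= #|G :&: D|.
Proof.
elim: {D}_.+1 {-2}D (ltnSn #|D|) => // m IHm D Dm blocked.
have [sub|] := boolP (I :&: D \subset G).
  by rewrite subset_leq_card // subsetI sub subsetIr.
case/subsetPn => x /setIP[xI xD] xG.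
pose P B := [&& B \in L, B \subset D & #|I :&: B| <= #|G :&: B|].
have [B0 [B0L xB0 B0D B0c]] := blocked x xI xD xG.
have PB0 : P B0 by rewrite /P B0L B0D.
case: (@arg_maxnP _ B0 P (fun B : {set 'I_n} => #|B|) PB0) => B /and3P[BL BD Bc] Bmax.
have Bpos : 0 < #|B|.
  by apply: leq_trans (Bmax _ PB0); apply/card_gt0P; exists x.
have lt : #|D :\: B| < m.
  by have := cardsID B D; rewrite (setIidPr BD); move: Bpos Dm; clear; lia.
rewrite -(cardsID B (I :&: D)) -(cardsID B (G :&: D)) -!setIA (setIidPr BD) -!setIDA.
apply: leq_add => //; apply: IHm => // y yI; rewrite inE => /andP[yB yD] yG.
have [B' [B'L yB' B'D B'c]] := blocked y yI yD yG; exists B'; split=> //.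
(* A [B'] meeting [B] is comparable with it; since [y] is in [B'] but not in [B], it would strictly
   contain [B], against maximality. *)
rewrite subsetD B'D -setI_eq0 /=; apply: contraT => /set0Pn[w /setIP[wB' wB]].
have [s|s] := laminar_comparable laminarL B'L BL wB' wB.
  by rewrite (subsetP s) in yB.
have : #|B'| <= #|B| by apply: Bmax; rewrite /P B'L B'D.
by rewrite leqNgt proper_card // properE s; apply/subsetPn; exists y.
Qed.

(** Inside a node [A] through [r], an element kept only by the filtered run is blocked in the
    complete run by a saturated [B]. As [r] was accepted, it is outside [B], so [B] lies in [A];
    thus [A] is no fuller in the filtered run. *)
Lemma greedy_filter (p : pred 'I_n) l r :
  r \in greedy l -> p r -> r \in greedy (filter p l).
Proof.
elim/last_ind: l r => [|l x IHl] r; first by rewrite inE.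
rewrite greedy_rcons filter_rcons => rG pr.
have [rl|rl] := boolP (r \in greedy l).
  by case: ifP => _; [rewrite greedy_rcons; case: ifP => _; rewrite ?inE IHl ?orbT|exact: IHl].
move: rG; case: ifP => [iU|_]; last by rewrite (negPf rl).
rewrite in_setU1 (negPf rl) orbF => /eqP rx; rewrite -rx in iU *; rewrite pr.
rewrite greedy_rcons; set G' := greedy (filter p l).
suff -> : indep (r |: G') by rewrite setU11.
apply/indepU1; first exact: greedy_indep.
move=> A AL rA _.
have free B : B \in L -> r \in B -> #|greedy l :&: B| < c B.
  by move=> BL rB; apply: (indepU1 _ (greedy_indep l) iU).
apply: leq_ltn_trans (free A AL rA); apply: card_le_blocked => y yG' yA yG.
have yl : y \in l by move/greedy_sub: yG'; rewrite mem_filter => /andP[].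
have [B [BL yB Bc]] := greedy_blocked yl yG; exists B; split=> //.
  have [AB|//] := laminar_comparable laminarL AL BL yA yB.
  by have := free B BL (subsetP AB _ rA); rewrite ltnNge Bc.
by apply: leq_trans Bc; have /forall_inP := greedy_indep (filter p l); apply.
Qed.

Variable pref : rel 'I_n.
Hypothesis prefP : linear_order pref.
Local Notation opt := (OPT indep pref).

Lemma OPT_indep Q : indep (opt Q).
Proof. exact: greedy_indep. Qed.

Lemma OPT_sub Q : opt Q \subset Q.
Proof.
by apply/subsetP => r /greedy_sub; rewrite mem_sort mem_enum.
Qed.

Lemma OPT_mono (X Y : {set 'I_n}) : X \subset Y -> opt Y :&: X \subset opt X.
Proof.
move=> XY; have [_ _ tr tot] := prefP.
apply/subsetP => r /setIP[rY rX].
have -> : opt X = greedy (filter [in X] (sort pref (enum Y))).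
  rewrite filter_sort // /OPT /greedy; congr (foldl _ _ (sort _ _)).
  rewrite {2}/enum_mem -filter_predI; apply: eq_filter => x /=.
  by case xX: (x \in X); rewrite //= (subsetP XY).
exact: greedy_filter.
Qed.

Lemma OPT_neq0 Q : Q != set0 -> opt Q != set0.
Proof.
move=> /set0Pn[x xQ]; apply/eqP => Q0.
have gQ0 : greedy (sort pref (enum Q)) = set0 := Q0.
have xl : x \in sort pref (enum Q) by rewrite mem_sort mem_enum.
have [|A [AL xA]] := greedy_blocked xl; first by rewrite gQ0 inE.
rewrite gQ0 set0I cards0 leqNgt; apply/negP/negPn.
by have [-> ] := capacitiesL.
Qed.

End Greedy.

(** * Forbidden sets *)

Section Arrivals.
Variables (n : nat) (sigma : 'S_n).

Lemma mem_arrived t (i : 'I_n) : (sigma i \in arrived sigma t) = (i < t).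
Proof.
rewrite /arrived; apply/imsetP/idP => [[j]|it]; last by exists i; rewrite ?inE.
by rewrite inE => jt /perm_inj ->.
Qed.

Lemma arrivedS (i : 'I_n) : arrived sigma i.+1 = sigma i |: arrived sigma i.
Proof.
apply/setP => x; rewrite -(permKV sigma x) in_setU1 !mem_arrived ltnS leq_eqVlt.
by rewrite (inj_eq perm_inj).
Qed.

Lemma arrived_subset s t : s <= t -> arrived sigma s \subset arrived sigma t.
Proof.
move=> st; apply/subsetP => x; rewrite -(permKV sigma x) !mem_arrived => xs.
exact: leq_trans st.
Qed.

Lemma arrived_neq0 t : 0 < n -> 0 < t -> arrived sigma t != set0.
Proof.
by move=> n0 t0; apply/set0Pn; exists (sigma (Ordinal n0)); rewrite mem_arrived.
Qed.

End Arrivals.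

Section Neighbours.
Variable n : nat.
Implicit Types (J : {set 'I_n}) (u x y : 'I_n).

(** The inequalities are vacuous at [x = u], so an element of [J] is its own neighbour; hence size
    three rather than two. *)
Definition neighbours J u : {set 'I_n} :=
  [set x in J | [forall y in J, ~~ ((x < y < u) || (u < y < x))]].

Lemma card_neighbours J u : #|neighbours J u| <= 3.
Proof.
have: {in neighbours J u &, forall x y, ~~ ((x < y < u) || (u < y < x))}.
  by move=> x y; rewrite !inE => /andP[_ /forall_inP Hx] /andP[yJ _]; apply: Hx.
move: (neighbours J u) => N NP.
have subN : N \subset u |: ([set x in N | x < u] :|: [set x in N | u < x]).
  apply/subsetP => x xN; rewrite !inE xN /=.
  by case: (ltngtP x u) => [||/val_inj ->]; rewrite ?orbT ?eqxx.
apply: leq_trans (subset_leq_card subN) _; rewrite cardsU1.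
apply: (@leq_add _ _ 1 2); first by case: (_ \notin _).
apply: leq_trans (leq_card_setU _ _) _; apply: (@leq_add _ _ 1 1).
- apply/card_le1_eqP => x y; rewrite !inE => /andP[xN xu] /andP[yN yu].
  by apply: val_inj; have := NP _ _ xN yN; have := NP _ _ yN xN; rewrite /=; lia.
- apply/card_le1_eqP => x y; rewrite !inE => /andP[xN xu] /andP[yN yu].
  by apply: val_inj; have := NP _ _ xN yN; have := NP _ _ yN xN; rewrite /=; lia.
Qed.

Lemma neighbours_self J u : u \in J -> u \in neighbours J u.
Proof. by move=> uJ; rewrite inE uJ /=; apply/forall_inP => y yJ; lia. Qed.

(** After its removal [x] is represented by the closest remaining element on one side, so nothing of
    [J] separates the two. *)
Lemma neighbours_represents L J x u :
  x \in J -> represents L (J :\ x) x u -> x \in neighbours J u.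
Proof.
move=> xJ [_ Hu]; rewrite inE xJ; apply/forall_inP => y yJ.
have [->|yx] := eqVneq y x; first by lia.
have yK : y \in J :\ x by rewrite in_setD1 yx.
case: (leqP x u) Hu => xu /(_ _ yK) Hy; apply/negP => /orP[|] /andP[].
- by move=> xy /Hy [yx' _]; lia.
- by move=> uy yx'; lia.
- by move=> xy yu; lia.
- by move=> /Hy [xy _] yx'; lia.
Qed.

End Neighbours.

Section Algorithm.
Variables (n : nat) (L : {set {set 'I_n}}) (c : {set 'I_n} -> nat).
Variable pref : rel 'I_n.
Hypothesis laminarL : laminar_family L.
Hypothesis convexL : forall (A : {set 'I_n}) (i j k : 'I_n),
  A \in L -> i \in A -> k \in A -> i <= j <= k -> j \in A.
Hypothesis capacitiesL : capacities L c.
Hypothesis prefP : linear_order pref.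
Implicit Types (J K A S X : {set 'I_n}) (sigma : 'S_n).
Local Notation indep := (laminar_indep L c).
Local Notation opt := (OPT indep pref).

(** Brings [representative] back from the extended tree to [[n]]; the default [y] is not reached for
    nonempty [J]. *)
Definition repr J (y : 'I_n) : 'I_n :=
  odflt y [pick z | leaf z == representative L J y].

Lemma leaf_repr J y : J != set0 -> leaf (repr J y) = representative L J y.
Proof.
move=> /(representativeP laminarL convexL y)[z rz _]; rewrite /repr.
by case: pickP => [w /eqP //|/(_ z)]; rewrite rz eqxx.
Qed.

Lemma reprP J y : J != set0 -> represents L J y (repr J y).
Proof.
move=> J0; have [z rz zP] := representativeP laminarL convexL y J0.
by have := leaf_repr y J0; rewrite rz => /leaf_inj ->.
Qed.

(** A node missing [J] has constant image, so it holds at most one element of [S], within any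
    positive capacity. For a node [A] meeting [J], [repr J] injects [S :&: A] into [J :&: A]. *)
Lemma indep_repr J S : J != set0 -> indep J -> {in S &, injective (repr J)} ->
  indep S.
Proof.
move=> J0 /forall_inP iJ injS; apply/forall_inP => A AL.
have [JA|/pred0Pn[w /andP[/= wJ wA]]] := boolP [disjoint J & A].
  apply: (@leq_trans 1); last by have [-> ] := capacitiesL.
  apply/card_le1_eqP => x y /setIP[xS xA] /setIP[yS yA]; apply: injS => //.
  apply: (@represents_uniq _ L J y); first exact: reprP.
  exact: (represents_const laminarL convexL (reprP x J0) AL).
apply: leq_trans (iJ _ AL).
rewrite -(card_in_imset (f := repr J) (D := S :&: A)); last first.
  by move=> x y /setIP[xS _] /setIP[yS _]; apply: injS.
apply/subset_leq_card/subsetP => _ /imsetP[x /setIP[_ xA] ->].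
have xP := reprP x J0; rewrite inE xP.1.
exact: (represents_in laminarL convexL xP AL xA wA).
Qed.

Lemma repr_trans J K y : K \subset J -> K != set0 -> repr K (repr J y) = repr K y.
Proof.
move=> KJ K0; have J0 : J != set0.
  by apply: contraNneq K0 => J0; rewrite J0 subset0 in KJ.
apply: (@represents_uniq _ L K y); last exact: reprP.
exact: (represents_trans laminarL convexL KJ (reprP y J0) (reprP _ K0)).
Qed.

(* Removing from J an element that is not a neighbour of the representative of r and then
   adding arbitrary elements cannot merge the classes of q and r. *)
Lemma repr_neq_shrink J K q r x : J != set0 -> K != set0 -> J :\ x \subset K ->
  x \notin neighbours J (repr J r) ->
  repr J q != repr J r -> repr K q != repr K r.
Proof.
move=> J0 K0 JxK xN qr; set u := repr J r in xN qr *.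
have [uJ uP] := reprP r J0; rewrite -/u in uJ uP.
have ux : u != x by apply: contraNneq xN => <-; apply: neighbours_self.
have uJx : u \in J :\ x by rewrite in_setD1 ux.
have Jx0 : J :\ x != set0 by apply/set0Pn; exists u.
have sJx : J :\ x \subset J by apply: subsetDl.
have ruE : repr (J :\ x) r = u.
  rewrite -(repr_trans r sJx) //; exact/represents_mem/reprP.
(* Equality over [K] passes down to [J :\ x], where [r] still maps to [u]. Surviving elements
   represent themselves, so only [v = x] can be sent to [u] without being [u]. *)
apply: contraNneq xN => Kqr.
have := congr1 (repr (J :\ x)) Kqr; rewrite !repr_trans // ruE -(repr_trans q sJx) // => vu.
set v := repr J q in qr vu; have [vJ _] := reprP q J0; rewrite -/v in vJ.
have vx : v = x.
  apply/eqP; apply: contraNT qr => vx.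
  rewrite -vu; apply/eqP/esym/(@represents_mem _ L (J :\ x)); last exact: reprP.
  by rewrite in_setD1 vx.
rewrite vx in vJ vu; apply: (@neighbours_represents _ L) => //.
by rewrite -vu; apply: reprP.
Qed.

Definition forbidden X (r : 'I_n) : {set 'I_n} :=
  neighbours (opt X) (repr (opt X) r).

Lemma repr_neq sigma (s : nat) (j : 'I_n) r : 0 < s -> s <= j ->
  sigma j \in opt (arrived sigma j.+1) ->
  (forall i : 'I_n, s <= i <= j ->
     sigma i \notin forbidden (arrived sigma i.+1) r) ->
  repr (opt (arrived sigma s)) (sigma j) != repr (opt (arrived sigma s)) r.
Proof.
move=> s0 sj jopt notF; have n0 : 0 < n by apply: leq_ltn_trans (ltn_ord j).
have opt0 k : 0 < k -> opt (arrived sigma k) != set0.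
  by move=> k0; apply: OPT_neq0 => //; apply: arrived_neq0.
(* Backward induction on [d = j + 1 - s]; [d = 0] contradicts [s <= j]. *)
have [d dE] : exists d, s + d = j.+1 by exists (j.+1 - s); lia.
elim: d s s0 sj notF dE => [|d IHd] s s0 sj notF dE.
  by move: sj dE; clear; lia.
have si : s < n by apply: leq_ltn_trans (ltn_ord j).
pose i := Ordinal si.
have : repr (opt (arrived sigma i.+1)) (sigma j) != repr (opt (arrived sigma i.+1)) r.
  have [lt|ge] := ltnP s j.
    apply: IHd => //; last by rewrite addSnnS.
    by move=> k /andP[sk kj]; apply: notF; rewrite kj andbT ltnW.
  (* Base level: [sigma j] represents itself, so a common image would make it the representative of
     [r], hence forbidden. *)
  have ij : i = j by apply: val_inj; apply/eqP; rewrite eqn_leq /= sj ge.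
  rewrite ij (represents_mem jopt (reprP _ (opt0 j.+1 _))) //.
  apply: contraNneq (notF j _) => [jE|]; last by rewrite sj leqnn.
  rewrite /forbidden -jE; exact: neighbours_self.
apply: (@repr_neq_shrink _ _ _ _ (sigma i)); rewrite ?opt0 //; last by apply: notF; rewrite /= leqnn.
(* Going back from time [s + 1] to [s], only [sigma s] can leave the optimum. *)
apply: subset_trans (OPT_mono c laminarL prefP (arrived_subset sigma (leqnSn s))).
apply/subsetP => x; rewrite in_setD1 => /andP[xi xo]; rewrite inE xo /=.
have := subsetP (OPT_sub L c pref _) _ xo.
by rewrite -/(nat_of_ord i) arrivedS in_setU1 (negPf xi).
Qed.

Section Loop.
Variables (s : nat) (sigma : 'S_n).
Hypothesis s_gt0 : 0 < s.
Local Notation J := (opt (arrived sigma s)).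
Local Notation run l := (foldl (laminar_step L c pref s sigma) (set0, set0) l).

(** Loop invariant: the blocked set is exactly the image of the selection, so the freshness test
    preserves injectivity. *)
Lemma runP (l : seq 'I_n) :
  [/\ (run l).2 = representative L J @: (run l).1,
      {in (run l).1 &, injective (representative L J)}
    & forall x, x \in (run l).1 -> exists i, [/\ i \in l, x = sigma i
        & sigma i \in opt (arrived sigma i.+1)]].
Proof.
elim/last_ind: l => [|l i [IH2 IHinj IHl]] /=.
  by split=> [|x y|x]; rewrite ?imset0 ?inE.
rewrite foldl_rcons; move: (foldl _ _ l) IH2 IHinj IHl => st IH2 IHinj IHl.
rewrite /laminar_step /laminar_OPT; case: ifP => [/andP[io iB]|_] /=.
- split=> [|x y|x].
  + by rewrite imsetU1 IH2.
  + have fresh z : z \in st.1 ->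
        representative L J z <> representative L J (sigma i).
      by move=> zA zE; case/negP: iB; rewrite IH2 -[X in X \in _]zE imset_f.
    rewrite !in_setU1 => /orP[/eqP ->|xA] /orP[/eqP ->|yA] //; last exact: IHinj.
      by move/esym/(fresh _ yA).
    by move/(fresh _ xA).
  + rewrite in_setU1 => /orP[/eqP ->|/IHl[j [jl xj jo]]].
      by exists i; rewrite mem_rcons mem_head.
    by exists j; rewrite mem_rcons in_cons jl orbT.
- split=> // x /IHl[j [jl xj jo]].
  by exists j; rewrite mem_rcons in_cons jl orbT.
Qed.

Lemma run_mono l1 l2 : (run l1).1 \subset (run (l1 ++ l2)).1.
Proof.
elim/last_ind: l2 => [|l i IHl]; first by rewrite cats0.
rewrite -rcons_cat foldl_rcons; apply: subset_trans IHl _.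
move: (foldl _ _ (l1 ++ l)) => st.
by rewrite /laminar_step; case: ifP => _ //=; apply: subsetUr.
Qed.

End Loop.

Lemma laminar_output_indep (s : 'I_n.+1) sigma :
  0 < n -> indep (laminar_output L c pref s sigma).
Proof.
move=> n0; rewrite /laminar_output; case: ifPn => [_|]; last rewrite -lt0n => s0.
  apply/forall_inP => A AL; apply: (@leq_trans 1); last by have [->] := capacitiesL.
  rewrite (arrivedS sigma (Ordinal n0)); apply: leq_trans (subset_leq_card (subsetIl _ _)) _.
  rewrite (_ : arrived _ _ = set0) ?setU0 ?cards1 //; apply/setP => x.
  by rewrite -(permKV sigma x) mem_arrived inE.
set l := filter _ _; have [_ inj _] := runP s sigma l.
have J0 : opt (arrived sigma s) != set0 by apply: OPT_neq0 => //; apply: arrived_neq0.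
apply: (indep_repr J0); first exact: OPT_indep.
move=> x y xA yA xy; apply: inj => //; by rewrite -!leaf_repr // xy.
Qed.

Lemma laminar_output_sample (s : 'I_n.+1) sigma (i : 'I_n) :
  i < s -> sigma i \notin laminar_output L c pref s sigma.
Proof.
move=> is_; rewrite /laminar_output gtn_eqF; last exact: leq_ltn_trans is_.
set l := filter _ _; have [_ _ inl] := runP s sigma l.
apply/negP => /inl[j [jl /perm_inj ij _]].
by move: jl; rewrite mem_filter -ij leqNgt is_.
Qed.

Lemma laminar_output_forbidden (s : 'I_n.+1) sigma (t : 'I_n) : s <= t ->
  sigma t \in opt (arrived sigma t.+1) ->
  (forall j : 'I_n, s <= j < t ->
     sigma j \notin forbidden (arrived sigma j.+1) (sigma t)) ->
  sigma t \in laminar_output L c pref s sigma.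
Proof.
move=> st topt notF; have n0 : 0 < n by apply: leq_ltn_trans (ltn_ord t).
rewrite /laminar_output; case: ifPn => [s0|]; last rewrite -lt0n => s0.
  (* With [s = 0] a later [t] violates [notF] at position 0: the optimum of one element is that
     element, which represents [sigma t] and is its own neighbour. *)
  rewrite mem_arrived ltnS leqNgt; apply/negP => t0.
  have H0 : s <= Ordinal n0 < t by rewrite (eqP s0) t0.
  apply/negP: (notF (Ordinal n0) H0).
  set X := arrived _ _; have X1 : X = [set sigma (Ordinal n0)].
    apply/setP => x; rewrite -(permKV sigma x) mem_arrived inE (inj_eq perm_inj).
    by rewrite ltnS leqn0.
  have X0 : opt X != set0.
    by apply: OPT_neq0 => //; rewrite X1; apply/set0Pn; exists (sigma (Ordinal n0)); rewrite inE.
  have [uX _] := reprP (sigma t) X0.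
  have := subsetP (OPT_sub L c pref X) _ uX; rewrite {2}X1 inE => /eqP uE.
  by rewrite /forbidden -[Y in Y \in _]uE; apply/negPn/neighbours_self.
set l := filter _ _.
have tl : t \in l by rewrite mem_filter st mem_enum.
have sl : sorted (fun i j : 'I_n => i < j) l.
  apply: sorted_filter; first by move=> i j k; apply: ltn_trans.
  by have := iota_ltn_sorted 0 n; rewrite -val_enum_ord sorted_map.
have /all_filterP lP : all (fun i : 'I_n => s <= i) l by apply: filter_all.
case/splitPr: tl sl lP => l1 l2 sl lP.
have l1P i : i \in l1 -> s <= i < t.
  move=> il; have : i \in l1 ++ t :: l2 by rewrite mem_cat il.
  rewrite -lP mem_filter => /andP[-> _] /=.
  move: sl; rewrite sorted_pairwise; last by move=> a b d; apply: ltn_trans.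
  rewrite pairwise_cat allrel_consr => /andP[/andP[/allP lt _] _]; exact: lt.
rewrite -cat_rcons; apply: (subsetP (run_mono _ _ _ _)).
rewrite foldl_rcons; have [run2 _ runl] := runP s sigma l1.
move: (foldl _ _ l1) run2 runl => state run2 runl.
rewrite /laminar_step /laminar_OPT topt /=; case: ifPn => [_|]; first by rewrite setU11.
rewrite negbK run2 => /imsetP[x /runl[j [jl -> jo]]] repE.
have /andP[sj jt] := l1P j jl.
have J0 : opt (arrived sigma s) != set0 by apply: OPT_neq0 => //; apply: arrived_neq0.
have /eqP[] : repr (opt (arrived sigma s)) (sigma j)
              != repr (opt (arrived sigma s)) (sigma t).
  apply: repr_neq => // i /andP[si ij]; apply: notF.
  by rewrite si (leq_ltn_trans ij).
by apply: leaf_inj; rewrite !leaf_repr.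
Qed.

Lemma laminar_forbidden_sets (R : realType) (p : R) :
  0 < n -> has_forbidden_sets indep pref p 3 (laminar_algorithm L c pref p).
Proof.
move=> n0; split=> [s sigma||]; first exact: laminar_output_indep.
  by split=> // s sigma i; apply: laminar_output_sample.
exists (fun X _ r => forbidden X r); split=> [X _ r _ _|s sigma t]; last exact: laminar_output_forbidden.
rewrite card_neighbours; split=> //; apply: subset_trans (OPT_sub L c pref X).
by apply/subsetP => x; rewrite inE => /andP[].
Qed.

End Algorithm.

(** * Success probability *)

Section Counting.
Variables (n k : nat) (F : {set 'I_n} -> {set 'I_n} -> {set 'I_n}).
Variables (t e : 'I_n).

(** [F] is already specialised to [e]. Lowering [m] from [t] imposes the avoidance conditions one
    position at a time. *)
Definition unblocked (m : nat) : {set 'S_n} :=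
  [set sigma : 'S_n | (sigma t == e) &&
    [forall j : 'I_n, (m <= j < t) ==>
       (sigma j \notin F (arrived sigma j.+1) (arrived sigma t.+1))]].

Lemma arrived_tperm (sigma : 'S_n) (i j : 'I_n) m : i < m -> j < m ->
  arrived (tperm i j * sigma)%g m = arrived sigma m.
Proof.
move=> im jm; apply/setP => x.
rewrite -(permKV sigma x) mem_arrived; set y := (sigma^-1)%g x.
have -> : sigma y = (tperm i j * sigma)%g (tperm i j y) by rewrite permM tpermK.
by rewrite mem_arrived; case: tpermP => [->|->|]; rewrite ?im ?jm.
Qed.

Lemma unblocked_tperm (sigma : 'S_n) m (i j : 'I_n) :
  m <= t -> i < m -> j < m ->
  ((tperm i j * sigma)%g \in unblocked m) = (sigma \in unblocked m).
Proof.
move=> mt im jm.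
have fixed (u : 'I_n) : m <= u -> (tperm i j * sigma)%g u = sigma u.
  move=> mu; rewrite permM tpermD //; apply: contraTneq mu => <-; by rewrite -ltnNge.
rewrite !inE fixed //; congr (_ && _); apply: eq_forallb => u.
case: andP => // -[mu ut] /=.
by rewrite fixed // !arrived_tperm // ltnS ltnW // (leq_trans im, leq_trans jm).
Qed.


(* Swapping the positions i <= m and m changes neither R_{m+1} nor any condition on later
   positions, so every element of R_{m+1} is equally likely to sit in position m. *)
Lemma unblocked_step (m : nat) : (forall X Y, #|F X Y| <= k) -> m < t ->
  (m.+1 - k) * #|unblocked m.+1| <= m.+1 * #|unblocked m|.
Proof.
move=> Fk mt; have mn : m < n := ltn_trans mt (ltn_ord t).
pose o := Ordinal mn.
pose G (sigma : 'S_n) := F (arrived sigma m.+1) (arrived sigma t.+1).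
have split sigma : (sigma \in unblocked m) =
    (sigma \in unblocked m.+1) && (sigma o \notin G sigma).
  rewrite !inE -andbA; congr (_ && _); apply/forall_inP/andP => [H|[/forall_inP H oG] j].
    split; last by apply: (H o); rewrite leqnn.
    by apply/forall_inP => j /andP[mj jt]; apply: H; rewrite (ltnW mj).
  case/andP=> mj jt; have [oj|] := eqVneq o j; first by rewrite -oj.
  rewrite -val_eqE /= => oj; apply: H; by rewrite jt andbT ltn_neqAle oj.
have count (i : 'I_n) : i < m.+1 ->
    #|unblocked m| = \sum_(sigma in unblocked m.+1) (sigma i \notin G sigma).
  move=> im; rewrite -sum1_card (eq_bigl _ _ split) big_mkcondr /=.
  rewrite (reindex_inj (mulgI (tperm i o))).
  apply: eq_big => [sigma|sigma _]; first exact: unblocked_tperm.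
  by rewrite /G !arrived_tperm // ?permM ?tpermR ?ltnS ?(ltnW mt) ?(ltnW (leq_trans im mt)).
have cardm : #|[set i : 'I_n | i < m.+1]| = m.+1.
  by rewrite -sum1dep_card (big_ord_narrow mn) sum1_card card_ord.
(* Double counting of pairs [(i, sigma)]: each [i] gives the same count, and each [sigma] has at
   least [m.+1 - k] positions outside a set of size at most [k]. *)
have -> : m.+1 * #|unblocked m| =
    \sum_(i : 'I_n | i < m.+1) \sum_(sigma in unblocked m.+1) (sigma i \notin G sigma).
  rewrite -[X in X * _]cardm -sum_nat_cond_const.
  by apply: eq_bigr => i im; apply: count.
rewrite exchange_big /= mulnC -sum_nat_const; apply: leq_sum => sigma _.
rewrite -[X in X - _]cardm leq_subLR -sum1dep_card.
apply: (@leq_trans (\sum_(i : 'I_n | i < m.+1) ((sigma i \in G sigma) + (sigma i \notin G sigma)))).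
  by apply: leq_sum => i _; case: (sigma i \in G sigma).
rewrite big_split leq_add2r /=; apply: leq_trans (Fk (arrived sigma m.+1) (arrived sigma t.+1)).
rewrite -(card_preimset (G sigma) (@perm_inj _ sigma)) -sum1_card big_mkcond [X in _ <= X]big_mkcond /=.
by apply: leq_sum => i _; rewrite inE; case: ifP => // _; case: (sigma i \in G sigma).
Qed.

(** At [m = t] only [sigma t == e] remains; swapping positions shows that every position holds [e]
    equally often. *)
Lemma unblocked_last : n * #|unblocked t| = n`!.
Proof.
have last sigma : (sigma \in unblocked t) = (sigma t == e).
  rewrite inE; case: eqP => //= _; apply/forall_inP => j /andP[tj].
  by rewrite ltnNge tj.
have count (i : 'I_n) : #|unblocked t| = \sum_(sigma : 'S_n) (sigma i == e).
  rewrite -sum1_card (eq_bigl _ _ last) big_mkcond (reindex_inj (mulgI (tperm i t))).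
  by apply: eq_bigr => sigma _; rewrite permM tpermR; case: eqP.
rewrite -[n in n * _]card_ord -sum_nat_const (eq_bigr _ (fun i _ => count i)).
rewrite exchange_big /= -card_Sn -sum1_card; apply: eq_bigr => sigma _.
rewrite (bigD1 ((sigma^-1)%g e)) //= permKV eqxx big1 // => i ie.
by rewrite -(permKV sigma e) (inj_eq perm_inj) (negPf ie).
Qed.

End Counting.

Import Order.TTheory GRing.Theory Num.Theory.
Local Open Scope ring_scope.

Section Survival.
Variable R : realType.

(* A lower bound for the probability that none of r_{s+1}, ..., r_t is forbidden; the
   subtraction is truncated, so the factors with j < k vanish. *)
Definition survival (k s t : nat) : R :=
  \prod_(s <= j < t) ((j.+1 - k)%:R / j.+1%:R).

Lemma survival_ge0 k s t : 0 <= survival k s t.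
Proof. by apply: prodr_ge0 => j _; rewrite divr_ge0. Qed.

Lemma survival_unblocked n k (F : {set 'I_n} -> {set 'I_n} -> {set 'I_n}) (t e : 'I_n) (s : nat) :
  (forall X Y, (#|F X Y| <= k)%N) -> (s <= t)%N ->
  survival k s t / n%:R <= #|unblocked F t e s|%:R / n`!%:R.
Proof.
move=> Fk; have n0 : (0 < n)%N by apply: leq_ltn_trans (ltn_ord t).
have [d] := ubnP (t - s); elim: d s => // d IHd s dE st.
have [ts|lt] := leqP t s.
  have -> : s = t by apply/eqP; rewrite eqn_leq st.
  rewrite /survival big_geq // -(unblocked_last F t e) natrM mul1r invfM mulrCA.
  rewrite divff ?mulr1 // pnatr_eq0 -lt0n.
  by have := fact_gt0 n; rewrite -(unblocked_last F t e) muln_gt0 => /andP[].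
have step := unblocked_step (F := F) e Fk lt.
rewrite /survival big_ltn // -/(survival _ _ _) -[X in X <= _]mulrA.
apply: (@le_trans _ _ ((s.+1 - k)%:R / s.+1%:R * (#|unblocked F t e s.+1|%:R / n`!%:R))).
  rewrite ler_wpM2l ?divr_ge0 // IHd //; lia.
rewrite mulrA ler_wpM2r ?invr_ge0 // mulrAC ler_pdivrMr ?ltr0n //.
by rewrite -!natrM ler_nat mulnC [(_ * s.+1)%N]mulnC mulnC.
Qed.

Lemma prob_selected_survival n k (indep : pred {set 'I_n}) pref p
    (A : algorithm n R) (e : 'I_n) :
  has_forbidden_sets indep pref p k A -> 0 <= p <= 1 ->
  (forall Q : {set 'I_n}, e \in Q -> e \in OPT indep pref Q) ->
  \sum_(s < n.+1) binomial_pmf n p s * (\sum_(s <= t < n) survival k s t / n%:R)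
    <= prob_selected A e.
Proof.
move=> [_ [law _] [F [Fsize Fsel]]] p01 eopt; apply: ler_sum => s _.
rewrite law ler_wpM2l ?binomial_pmf_ge0 // card_Sn.
(* The size bound on [F] holds only for admissible triples; emptying oversized values makes it
   unconditional and changes nothing at the triples met below. *)
pose F' X Y := if (#|F X Y e| <= k)%N then F X Y e else set0.
have F'k X Y : (#|F' X Y| <= k)%N by rewrite /F'; case: ifP; rewrite ?cards0.
have sel (sigma : 'S_n) (t : 'I_n) : (s <= t)%N -> sigma \in unblocked F' t e s ->
    sigma t = e /\ e \in output A s sigma.
  move=> st; rewrite inE => /andP[/eqP te /forall_inP H]; split=> //.
  rewrite -te in eopt F' F'k H *.
  have topt : sigma t \in OPT indep pref (arrived sigma t.+1).
    by apply: eopt; rewrite mem_arrived.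
  apply: Fsel => // j /andP[sj jt].
  have := H j; rewrite sj jt => /(_ isT); rewrite /F'.
  case: ifPn => // /negP[].
  apply: (Fsize _ _ _ topt _).2; rewrite subsetD1 arrived_subset ?ltnS ?(ltnW jt) //=.
  by rewrite mem_arrived -leqNgt.
rewrite big_geq_mkord -mulr_suml.
apply: (@le_trans _ _ ((\sum_(t < n | (s <= t)%N) #|unblocked F' t e s|)%:R / n`!%:R)).
  rewrite natr_sum !mulr_suml; apply: ler_sum => t st.
  exact: survival_unblocked.
rewrite ler_wpM2r ?invr_ge0 // ler_nat.
rewrite (eq_bigr (fun t : 'I_n => \sum_(sigma : 'S_n) (sigma \in unblocked F' t e s : nat))%N);
  last by move=> t _; rewrite -sum1_card big_mkcond; apply: eq_bigr => sigma _; case: ifP.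
rewrite exchange_big /= -sum1_card [leqRHS]big_mkcond /=; apply: leq_sum => sigma _.
(* For a fixed order at most one [t] contributes, the position of [e], and then [e] is selected. *)
have [[t /andP[st tu]]|none] := altP (@existsP _ (fun t : 'I_n =>
    (s <= t)%N && (sigma \in unblocked F' t e s))).
  have [te eA] := sel _ _ st tu.
  rewrite inE eA (bigD1 t) //= tu big1 // => u /andP[su ut].
  case ue: (sigma \in _) => //; have [ue' _] := sel _ _ su ue.
  by case/eqP: ut; apply: (@perm_inj _ sigma); rewrite ue'.
rewrite big1 // => t st; move: none; rewrite negb_exists => /forallP/(_ t).
by rewrite st /= => /negPf ->.
Qed.

End Survival.

(** * Factorial moments of the binomial law *)

Section Binomial.
Variables (R : realType) (p : R).

Lemma binomial_pmfSS n s :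
  binomial_pmf n.+1 p s.+1 * s.+1%:R = n.+1%:R * p * binomial_pmf n p s.
Proof.
rewrite /binomial_pmf subSS exprS -[_ *+ 'C(n.+1, _)]mulr_natr.
rewrite -[_ *+ 'C(n, _)]mulr_natr -!mulrA -natrM mulnC -mul_bin_diag natrM /=.
by move: (n.+1%:R) ('C(n, s)%:R) => u v; ring.
Qed.

(** [k = 0] is the binomial theorem; for [k + 1] the term [s = 0] vanishes and one factor is
    absorbed into the binomial coefficient. *)
Lemma binomial_factorial_moment n k :
  \sum_(s < n.+1) binomial_pmf n p s * (s ^_ k)%:R = (n ^_ k)%:R * p ^+ k.
Proof.
elim: k n => [|k IHk] n.
  rewrite ffactn0 expr0 mul1r; under eq_bigr do rewrite ffactn0 mulr1.
  have := exprDn (1 - p) p n; rewrite subrK expr1n => ->.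
  by apply: eq_bigr => s _; rewrite /binomial_pmf mulrC.
case: n => [|n]; first by rewrite big_ord1 !ffact0n /= mulr0 mul0r.
rewrite big_ord_recl ffact0n mulr0 add0r ffactSS natrM.
under eq_bigr do rewrite /= /bump /= add1n ffactSS natrM mulrA binomial_pmfSS -mulrA.
by rewrite -mulr_sumr IHk exprS; ring.
Qed.

End Binomial.

(** * Closed form of the bound for forbidden sets of size three *)

Section Competitive.
Variable R : realType.
Local Notation survival := (@survival R).

Lemma ffact3 b : (b.+3 ^_ 3)%:R = (b%:R + 3) * (b%:R + 2) * (b%:R + 1) :> R.
Proof. by rewrite !ffactSS ffactn0 muln1 !natrM -!natr1; ring. Qed.

(** The product telescopes. Starting at [a.+3] turns truncated subtraction and falling factorials
    into polynomials. *)
Lemma survival3 a d :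
  survival 3 a.+3 (a.+3 + d) = (a.+3 ^_ 3)%:R / ((a.+3 + d) ^_ 3)%:R.
Proof.
have pos x : x%:R >= 0 :> R by rewrite ler0n.
elim: d => [|d IHd].
  rewrite addn0 /survival big_geq // divff // ffact3.
  have := pos a; move: (a%:R) => x x0; rewrite !mulf_neq0 //; lra.
rewrite addnS /survival big_nat_recr ?leq_addr //= -/(survival _ _ _) IHd.
rewrite !addSn !subSS subn0 !ffact3 -!natr1.
have := pos (a + d)%N; move: ((a + d)%:R) (a%:R) => x y x0.
by field; rewrite !lt0r_neq0 //; lra.
Qed.

(** [1/(t(t-1)(t-2))] is half of [1/((t-1)(t-2)) - 1/(t(t-1))], so the sum telescopes. *)
Lemma sum_survival3 a d :
  \sum_(a.+3 <= t < a.+3 + d) survival 3 a.+3 t =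
  (a.+3%:R - (a.+3 + d)%:R * ((a.+3 ^_ 3)%:R / ((a.+3 + d) ^_ 3)%:R)) / 2.
Proof.
have pos x : x%:R >= 0 :> R by rewrite ler0n.
elim: d => [|d IHd].
  rewrite addn0 big_geq // ffact3 -!natr1.
  have := pos a; move: (a%:R) => x x0; field; by rewrite !lt0r_neq0 //; lra.
rewrite addnS big_nat_recr ?leq_addr //= IHd survival3.
rewrite !addSn !ffact3 -!natr1.
have := pos (a + d)%N; move: ((a + d)%:R) (a%:R) => x y x0.
by field; rewrite !lt0r_neq0 //; lra.
Qed.

Lemma sum_survival_ge1 n s : (s < n)%N -> 1 <= \sum_(s <= t < n) survival 3 s t.
Proof.
move=> sn; rewrite big_ltn // {1}/survival big_geq // lerDl.
by apply: sumr_ge0 => t _; apply: survival_ge0.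
Qed.

(* An equality for 3 <= s; for s < 3 the term t = s alone suffices. *)
Lemma sum_survival_ge n s : (2 < n)%N -> (s <= n)%N ->
  (s%:R - n%:R * ((s ^_ 3)%:R / (n ^_ 3)%:R)) / 2
    <= \sum_(s <= t < n) survival 3 s t.
Proof.
move=> n2 sn; have [s3|s3] := leqP 3 s.
  by case: s s3 sn => [|[|[|a]]] // _ sn; rewrite -(subnKC sn) sum_survival3.
apply: le_trans (sum_survival_ge1 (leq_trans s3 n2)).
by rewrite ffact_small // mul0r mulr0 subr0 ler_pdivrMr // mul1r ler_nat.
Qed.

Lemma sum_binomial_survival n (p : R) : (0 < n)%N -> 0 <= p <= 1 ->
  (p - p ^+ 3) / 2 <=
  \sum_(s < n.+1) binomial_pmf n p s * (\sum_(s <= t < n) survival 3 s t / n%:R).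
Proof.
move=> n0 p01; have pmf0 k s : 0 <= binomial_pmf k p s by apply: binomial_pmf_ge0.
case/andP: (p01) => p0 p1.
have pmfE k s : binomial_pmf k p s = p ^+ s * (1 - p) ^+ (k - s) *+ 'C(k, s) by [].
have [n2|n2] := ltnP 2 n.
- have nR : n%:R != 0 :> R by rewrite pnatr_eq0 -lt0n.
  have ffR : (n ^_ 3)%:R != 0 :> R by rewrite pnatr_eq0 -lt0n ffact_gt0.
  apply: (@le_trans _ _ (\sum_(s < n.+1) binomial_pmf n p s *
      ((s%:R - n%:R * ((s ^_ 3)%:R / (n ^_ 3)%:R)) / 2 / n%:R))); last first.
    apply: ler_sum => s _; rewrite -mulr_suml ler_wpM2l // ler_wpM2r ?invr_ge0 //.
    by apply: sum_survival_ge => //; rewrite -ltnS.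
  rewrite le_eqVlt; apply/orP; left; apply/eqP.
  transitivity ((\sum_(s < n.+1) binomial_pmf n p s * (s ^_ 1)%:R) / n%:R / 2
     - (\sum_(s < n.+1) binomial_pmf n p s * (s ^_ 3)%:R) / (n ^_ 3)%:R / 2).
    rewrite !binomial_factorial_moment ffactn1; field; rewrite ffR; exact: nR.
  rewrite !mulr_suml -sumrB; apply: eq_bigr => s _; rewrite ffactn1.
  by field; rewrite ffR nR.
(* For [n <= 2] the denominator [n ^_ 3] vanishes; the bound [1 / n] on the inner sum for [s < n] is
   enough. *)
- have lower s : (s < n)%N -> n%:R^-1 <= \sum_(s <= t < n) survival 3 s t / n%:R.
    by move=> sn; rewrite -mulr_suml ler_peMl ?invr_ge0 // sum_survival_ge1.
  rewrite big_ord_recr /= [X in _ + _ * X]big_geq // mulr0 addr0.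
  apply: (@le_trans _ _ (\sum_(s < n) binomial_pmf n p s / n%:R)); last first.
    by apply: ler_sum => s _; rewrite ler_wpM2l // lower.
  (* [h1 + h2] is [2(1 - p) - (p - p^3)], for [n = 1]; [h1] is [(1 - p^2) - (p - p^3)], for
     [n = 2]. *)
  have h1 : 0 <= (1 - p) * (1 - p) * (1 + p) by rewrite !mulr_ge0 ?subr_ge0 ?addr_ge0.
  have h2 : 0 <= (1 - p) * (1 - p) by rewrite mulr_ge0 ?subr_ge0.
  case: n n0 n2 {lower} => [|[|[|]]] // _ _.
    rewrite big_ord1 pmfE bin0 subn0 expr0 mulr1n expr1; lra.
  rewrite big_ord_recl big_ord1 !pmfE /bump /= !bin0 bin1 subn0 subSS subn0; lra.
Qed.

End Competitive.

(** This [p] maximises [p - p^3] on [[0, 1]]; there [p^3 = p / 3]. *)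
Lemma inv_sqrt3 (R : realType) (p := 1 / Num.sqrt 3 : R) :
  0 <= p <= 1 /\ (p - p ^+ 3) / 2 = (3 * Num.sqrt 3)^-1.
Proof.
have q0 : 0 < Num.sqrt 3 :> R by rewrite sqrtr_gt0.
have q2 : Num.sqrt 3 ^+ 2 = 3 :> R by rewrite sqr_sqrtr.
rewrite /p {p}; move: (Num.sqrt 3) q0 q2 => q q0 q2; split.
  rewrite divr_ge0 ?(ltW q0) //= ler_pdivrMr // mul1r; nra.
have -> : (1 / q) ^+ 3 = (1 / q) / 3 by rewrite -q2; field; rewrite lt0r_neq0.
by field; rewrite lt0r_neq0.
Qed.

Theorem theorem9 (R : realType) (n : nat)
    (L : {set {set 'I_n}}) (c : {set 'I_n} -> nat)
    (lft : rel {set 'I_n}) (pref : rel 'I_n) :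
  laminar_family L -> capacities L c ->
  drawing L lft -> numbered_left_to_right L lft ->
  linear_order pref ->
  (forall p : R, 0 <= p <= 1 ->
     has_forbidden_sets (laminar_indep L c) pref p 3
       (laminar_algorithm L c pref p)) /\
  probability_competitive (laminar_indep L c) pref (3 * Num.sqrt 3 : R)
    (laminar_algorithm L c pref (1 / Num.sqrt 3 : R)).
Proof.
move=> lamL capL _ numL prefP.
have convL := numbered_convex lamL numL.
have n0 : (0 < n)%N.
  case: n L c lft pref lamL {capL numL prefP convL} => // L _ _ _ [_ /negP L0 LT _].
  by case: L0; rewrite (_ : set0 = setT) //; apply/setP => -[].
split=> [p _|e eopt]; first exact: laminar_forbidden_sets.
have [p01 <-] := inv_sqrt3 R.
apply: le_trans (sum_binomial_survival n0 p01) _.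
apply: (prob_selected_survival _ p01 (indep := laminar_indep L c) (pref := pref)).
  exact: laminar_forbidden_sets.
(* An element of the global optimum stays optimal in every set containing it. *)
move=> Q eQ; apply: (subsetP (OPT_mono c lamL prefP (subsetT Q))).
by rewrite inE eopt.
Qed.
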